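(* Let $\{V_m\}_{m\in\mathbb N}$ be a sequence of $N\times N$ matrix polynomials with real coefficients such that $V_m$ has degree $m$ with non-singular lower triangular leading coefficient, $V_{0}(z)=I_{N\times N}$, and put $V_{-1}(z)=0_{N\times N}$. Then the following statements are equivalent. (a) $\{V_m\}$ is left-orthogonal with respect to some $N\times N$ matrix of measures $W$ on $\mathbb R$ (not necessarily positive definite). (b) There are sequences of $N\times N$ real matrices $\{A_m\}_{m\in\mathbb N}$, $\{B_m\}_{m\in\mathbb N}$ and $\{C_m\}_{m\in\mathbb N}$, with $A_m$ lower triangular and $C_{m+1}$ upper triangular, non-singular for $m\in\mathbb N$, such that $$zV_m(z)=A_mV_{m+1}(z)+B_mV_m(z)+C_mV_{m-1}(z),\qquad m\ge1.$$
   Context: $N\ge1$ is a fixed integer and $\mathbb N=\{0,1,2,\dots\}$. A matrix of measures $W$ is an $N\times N$ matrix whose entries are (signed) Borel measures on $\mathbb R$ with finite moments of all orders. The sequence $\{V_m\}$ is left-orthogonal with respect to $W$ if $$\int_{\mathbb R}V_m(x)\,dW(x)\,x^k=\Omega^1_m\,\delta_{k,m},\qquad 0\le k\le m,\ m\in\mathbb N,$$ where each $\Omega^1_m$ is a non-singular upper triangular matrix and $\delta_{k,m}$ is the Kronecker delta. *)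

(* Defs.v *)
From mathcomp Require Import all_boot all_order all_algebra.
From mathcomp Require Import all_classical all_reals all_analysis.

Set Implicit Arguments.
Unset Strict Implicit.
Unset Printing Implicit Defensive.

Import Order.TTheory GRing.Theory Num.Theory.
Import numFieldNormedType.Exports.

Local Open Scope classical_set_scope.
Local Open Scope ring_scope.

Section SignedMeasure.
Context {d : measure_display} {T : measurableType d} {R : realType}.
Variable nu : {charge set T -> \bar R}.

(* A Hahn decomposition is chosen once and for all; it is unique only up to
   null sets, but the Jordan parts it induces do not depend on the choice. *)
Definition hahn_pos_set : set T := projT1 (cid (Hahn_decomposition nu)).

Definition hahn_neg_set : set T :=
  projT1 (cid (projT2 (cid (Hahn_decomposition nu)))).

Definition hahn_setsP : hahn_decomposition nu hahn_pos_set hahn_neg_set :=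
  projT2 (cid (projT2 (cid (Hahn_decomposition nu)))).

Definition charge_integrable (f : T -> R) : Prop :=
  (charge_variation hahn_setsP).-integrable setT (EFin \o f).

(* Meaningful only when f is charge_integrable. *)
Definition charge_integral (f : T -> R) : R :=
  \int[jordan_pos hahn_setsP]_x f x - \int[jordan_neg hahn_setsP]_x f x.

End SignedMeasure.

(* measurableTypeR R is R with its Borel sigma-algebra. A charge takes finite
   values, which loses nothing here: the moments of order 0 are finite. *)
Definition borel_charge (R : realType) : Type :=
  {charge set (measurableTypeR R) -> \bar R}.

Definition finite_moments (R : realType) (N : nat)
    (W : 'M[borel_charge R]_N) : Prop :=
  forall (i j : 'I_N) (k : nat),
    charge_integrable (W i j) (fun x : measurableTypeR R => (x : R) ^+ k).

(* The matrix integral of F(x) dW(x) g(x), for g scalar valued. *)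
Definition mx_integral (R : realType) (N : nat) (F : R -> 'M[R]_N)
    (W : 'M[borel_charge R]_N) (g : R -> R) : 'M[R]_N :=
  \matrix_(i, j) \sum_(l < N)
    charge_integral (W l j) (fun x : measurableTypeR R => F x i l * g x).

(* Matrix sizes are written n.+1, so that square matrices form a ring and matrix
   polynomials are polynomials over that ring. *)

Definition mxpoly_eval (R : realType) (n : nat) (P : {poly 'M[R]_n.+1})
    (x : R) : 'M[R]_n.+1 := P.[x%:M].

(* is_trig_mx means lower triangular. *)
Definition left_orthogonal (R : realType) (n : nat)
    (V : nat -> {poly 'M[R]_n.+1}) (W : 'M[borel_charge R]_n.+1) : Prop :=
  exists Omega : nat -> 'M[R]_n.+1,
    (forall m, is_trig_mx (Omega m)^T /\ Omega m \in unitmx) /\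
    (forall m k, (k <= m)%N ->
       mx_integral (mxpoly_eval (V m)) W (fun x => x ^+ k)
       = if k == m then Omega m else 0).

(* V_{m-1}, with the convention V_{-1} = 0. *)
Definition prev_poly (R : realType) (n : nat)
    (V : nat -> {poly 'M[R]_n.+1}) (m : nat) : {poly 'M[R]_n.+1} :=
  if m is k.+1 then V k else 0.

(* Main.v *)
Require Import Defs.
From HB Require Import structures.
From mathcomp Require Import all_boot all_order all_algebra.
From mathcomp Require Import all_classical all_reals all_analysis.
From mathcomp Require Import measurable_realfun ring.

(** This is Favard's theorem for matrix measures that need not be positive.
    Orthogonality only involves the moments [mu d] of [W], through the
    left-linear functional [L] on matrix polynomials that sends [x^d] to [mu d]
    ([moment_form]). The theorem therefore splits into an algebraic part about
    [L] and a moment problem.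

    From orthogonality to the recurrence. The functional is nondegenerate: a
    polynomial of degree less than [m] with [L(Q x^k) = 0] for all [k < m] is zero
    ([moment_form_nondegenerate]). The coefficients [A m], [C m] and [B m] are
    chosen so that [Q = x V_m - A_m V_{m+1} - B_m V_m - C_m V_{m-1}] loses its
    coefficients of degree [m+1] and [m] and is orthogonal to [x^{m-1}]; it is
    orthogonal to the lower powers because the [V_j] are. Hence [Q = 0].
    Triangularity of [A_m = lead V_m (lead V_{m+1})^-1] and
    [C_m = Omega_m Omega_{m-1}^-1] comes from that of the factors
    ([recurrence_of_orthogonal]).

    From the recurrence to orthogonality. The leading coefficients being
    invertible, there are moments with [L(V_0) = 1] and [L(V_m) = 0] for [m >= 1]
    ([moments_exist]). The recurrence gives [L(V_m x^k) = C_m L(V_{m-1} x^{k-1})]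
    for [1 <= k <= m], so that [L(V_m x^k) = 0] for [k < m] and
    [Omega_m = C_m ... C_1] ([orthogonal_of_recurrence]). It remains to find,
    for each matrix entry, a signed measure with the given real moments. No
    positivity condition is in the way: any real sequence is the moment sequence of a
    signed measure ([signed_measure_with_moments]). Such a measure is a sum of
    finitely supported blocks, where the [k]-th block has vanishing moments of
    order below [k], has the moment of order [k] that is still missing, and is
    spread out so far that its absolute moments of order below [k] are at most
    [2^-(k+1)]; so all absolute moments of the sum converge.

    Integrals against a signed measure are defined by its Jordan
    decomposition, while the construction produces some other difference of two
    finite measures; [charge_integral_difference] shows that both give the same
    integrals. *)

Set Implicit Arguments.
Unset Strict Implicit.
Unset Printing Implicit Defensive.

Import Order.TTheory GRing.Theory Num.Theory.
Import numFieldNormedType.Exports.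

Local Open Scope classical_set_scope.
Local Open Scope ring_scope.

(** * Triangular matrices *)

Lemma is_trig_mxM (R : pzRingType) n (A B : 'M[R]_n) :
  is_trig_mx A -> is_trig_mx B -> is_trig_mx (A *m B).
Proof.
move=> /is_trig_mxP At /is_trig_mxP Bt; apply/is_trig_mxP => i j lt_ij.
rewrite mxE big1 // => k _; have [lt_ik|le_ki] := ltnP i k.
  by rewrite At // mul0r.
by rewrite Bt ?mulr0 // (leq_ltn_trans le_ki).
Qed.

Lemma trig_unit_diag (F : fieldType) n (A : 'M[F]_n) i :
  is_trig_mx A -> A \in unitmx -> A i i != 0.
Proof.
by move=> At; rewrite unitmxE det_trig // unitfE => /prodf_neq0 ->.
Qed.

(** Forward substitution: row [i] of [A *m invmx A = 1] expresses
    [invmx A i j] through the entries [invmx A k j] with [k < i]. *)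
Lemma is_trig_invmx (F : fieldType) n (A : 'M[F]_n) :
  is_trig_mx A -> A \in unitmx -> is_trig_mx (invmx A).
Proof.
move=> At Au; apply/is_trig_mxP => i j.
have [m] := ubnP (nat_of_ord i).
elim: m i => // m IH i; rewrite ltnS => le_im lt_ij.
have /matrixP/(_ i j) := mulmxV Au.
rewrite !mxE (bigD1 i) //= big1 ?addr0 => [|k neq_ki].
  rewrite -val_eqE /= ltn_eqF // mulr0n => /eqP.
  by rewrite mulf_eq0 (negPf (trig_unit_diag i At Au)) => /eqP.
move: neq_ki; rewrite -val_eqE neq_ltn => /orP[lt_ki|lt_ik].
  rewrite IH ?mulr0 //; first exact: leq_trans lt_ki le_im.
  exact: ltn_trans lt_ki lt_ij.
by move/is_trig_mxP: At => -> //; rewrite mul0r.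
Qed.

(** * Moment functionals on matrix polynomials *)

Section MomentFunctional.
Variables (M : nzRingType) (mu : nat -> M).
Implicit Types (P Q : {poly M}).

(** The value of [P(x) x^k] under the left-linear functional that sends [x^d] to
    [mu d]. The factor [x^k] shifts the moments, so that no product of
    polynomials is formed. *)
Definition moment_form k P : M := \sum_(d < size P) P`_d * mu (d + k)%N.

Lemma moment_form_widen k P N : (size P <= N)%N ->
  moment_form k P = \sum_(d < N) P`_d * mu (d + k)%N.
Proof.
move=> le_PN; rewrite /moment_form.
rewrite (big_ord_widen _ (fun d => P`_d * mu (d + k)%N) le_PN) big_mkcond.
by apply: eq_bigr => d _; case: ltnP => // le_Pd; rewrite nth_default ?mul0r.
Qed.

Lemma moment_form0 k : moment_form k 0 = 0.
Proof. by rewrite /moment_form size_poly0 big_ord0. Qed.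

Lemma moment_formB k P Q :
  moment_form k (P - Q) = moment_form k P - moment_form k Q.
Proof.
pose N := maxn (size P) (size Q).
have le_PN : (size P <= N)%N by apply: leq_maxl.
have le_QN : (size Q <= N)%N by apply: leq_maxr.
have le_PQN : (size (P - Q)%R <= N)%N.
  by rewrite (leq_trans (size_polyD _ _)) // size_polyN.
rewrite !(@moment_form_widen k _ N) // -sumrB.
by apply: eq_bigr => d _; rewrite coefB mulrBl.
Qed.

Lemma moment_formCM k c P : moment_form k (c%:P * P) = c * moment_form k P.
Proof.
have le_cP : (size (c%:P * P)%R <= size P)%N.
  by rewrite mul_polyC (leq_trans (size_scale_leq _ _)).
rewrite (moment_form_widen _ le_cP) mulr_sumr.
by apply: eq_bigr => d _; rewrite coefCM mulrA.
Qed.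

Lemma moment_formD k P Q :
  moment_form k (P + Q) = moment_form k P + moment_form k Q.
Proof.
rewrite -[Q in LHS]opprK moment_formB -[- Q]sub0r moment_formB moment_form0.
by rewrite sub0r opprK.
Qed.

Lemma moment_formXM k P : moment_form k ('X * P) = moment_form k.+1 P.
Proof.
have le_XP : (size ('X * P)%R <= (size P).+1)%N.
  apply/leq_sizeP => -[//|i]; rewrite ltnS coefXM => le_Pi.
  by rewrite nth_default.
rewrite (moment_form_widen _ le_XP) big_ord_recl coefXM mul0r add0r.
by apply: eq_bigr => d _; rewrite coefXM /= /bump /= add1n addSnnS.
Qed.

End MomentFunctional.

Section Favard.
Variables (F : fieldType) (n : nat) (V : nat -> {poly 'M[F]_n.+1}).
Hypothesis V_size : forall m, size (V m) = m.+1.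
Hypothesis V_lead_trig : forall m, is_trig_mx (lead_coef (V m)).
Hypothesis V_lead_unit : forall m, lead_coef (V m) \in unitmx.

Let V_coef m : (V m)`_m = lead_coef (V m).
Proof. by rewrite lead_coefE V_size. Qed.

Let V_coef0 m i : (m < i)%N -> (V m)`_i = 0.
Proof. by move=> lt_mi; rewrite nth_default ?V_size. Qed.

(** The orthogonality relations determine the leading coefficient of a
    polynomial [Q] of degree [m]: it has to be [c] times that of [V m], and
    pairing with [x^m] gives [c * Omega m = 0]. *)
Lemma moment_form_nondegenerate (mu Omega : nat -> 'M[F]_n.+1) :
  (forall m, Omega m \in unitmx) ->
  (forall m k, (k <= m)%N ->
     moment_form mu k (V m) = if k == m then Omega m else 0) ->
  forall m (Q : {poly 'M[F]_n.+1}), (size Q <= m)%N ->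
    (forall k, (k < m)%N -> moment_form mu k Q = 0) -> Q = 0.
Proof.
move=> Ou Vorth; elim=> [|m IH] Q szQ Qorth.
  by apply/eqP; rewrite -size_poly_eq0 -leqn0.
pose c : 'M[F]_n.+1 := Q`_m * (lead_coef (V m))^-1.
have QE : Q = c%:P * V m.
  apply/eqP; rewrite -subr_eq0; apply/eqP/IH => [|k lt_km].
    apply/leq_sizeP => i; rewrite leq_eqVlt coefB coefCM => /predU1P[<-|lt_mi].
      by rewrite V_coef /c divrK ?subrr //; exact: V_lead_unit.
    by rewrite V_coef0 // mulr0 subr0 nth_default // (leq_trans szQ).
  rewrite moment_formB moment_formCM Qorth 1?ltnW // (Vorth m k (ltnW lt_km)).
  by rewrite ltn_eqF // mulr0 subr0.
have := Qorth m (ltnSn m).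
rewrite {1}QE moment_formCM Vorth // eqxx => cO.
by rewrite QE -[c](mulrK (Ou m)) cO mul0r polyC0 mul0r.
Qed.

(** Multiplication by [x] is symmetric for the functional, so [x V_m] is orthogonal
    to all powers below [m - 1], and only three terms survive. *)
Lemma recurrence_of_orthogonal (mu Omega : nat -> 'M[F]_n.+1) :
  (forall m, is_trig_mx (Omega m)^T /\ Omega m \in unitmx) ->
  (forall m k, (k <= m)%N ->
     moment_form mu k (V m) = if k == m then Omega m else 0) ->
  exists A B C : nat -> 'M[F]_n.+1,
    [/\ forall m, is_trig_mx (A m) /\ A m \in unitmx,
        forall m, is_trig_mx (C m.+1)^T /\ C m.+1 \in unitmx &
        forall m, 'X * V m.+1 = (A m.+1)%:P * V m.+2 + (B m.+1)%:P * V m.+1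
                                + (C m.+1)%:P * V m].
Proof.
move=> Otu Vorth; have Ou m : Omega m \is a GRing.unit by have [] := Otu m.
pose A m : 'M[F]_n.+1 := lead_coef (V m) * (lead_coef (V m.+1))^-1.
pose C m : 'M[F]_n.+1 := Omega m * (Omega m.-1)^-1.
pose Q m := 'X * V m.+1 - (A m.+1)%:P * V m.+2 - (C m.+1)%:P * V m.
pose B m : 'M[F]_n.+1 := (Q m.-1)`_m * (lead_coef (V m))^-1.
exists A, B, C; split=> m.
- split; last first.
    change (A m \is a GRing.unit).
    by rewrite /A unitrMl ?unitrV; exact: V_lead_unit.
  by rewrite is_trig_mxM ?is_trig_invmx ?V_lead_trig ?V_lead_unit.
- split; last first.
    change (C m.+1 \is a GRing.unit).
    by rewrite /C unitrMl ?unitrV; exact: Ou.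
  rewrite trmx_mul trmx_inv is_trig_mxM ?is_trig_invmx ?unitmx_tr ?Ou //.
    by have [] := Otu m.
  by have [] := Otu m.+1.
have Q0 : Q m - (B m.+1)%:P * V m.+1 = 0.
  apply: (moment_form_nondegenerate Ou Vorth (m := m.+1)) => [|k].
    (* A cancels the coefficient of degree m + 2, and B that of degree m + 1. *)
    apply/leq_sizeP => i; rewrite leq_eqVlt => /predU1P[<-|].
      by rewrite coefB coefCM V_coef divrK ?subrr //; exact: V_lead_unit.
    rewrite leq_eqVlt !coefB coefXM !coefCM => /predU1P[<-|lt_mi].
      rewrite /= !V_coef (@V_coef0 m) 1?(@V_coef0 m.+1) ?mulr0 ?subr0 //.
      by rewrite divrK ?subrr //; exact: V_lead_unit.
    case: i lt_mi => // i lt_mi.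
    by rewrite /= !V_coef0 ?mulr0 ?subr0 // ltnW // ltnW.
  rewrite ltnS => le_km; rewrite !moment_formB !moment_formCM moment_formXM.
  rewrite !Vorth // 1?ltnW // ?ltnS 1?ltnW // eqSS.
  rewrite (ltn_eqF (_ : (k < m.+1)%N)) //.
  rewrite (ltn_eqF (_ : (k < m.+2)%N)) 1?ltnW //.
  rewrite !mulr0 !subr0; case: eqP => _; last by rewrite mulr0 subr0.
  by rewrite /C /= divrK ?subrr.
by move/eqP: Q0; rewrite subr_eq0 !subr_eq => /eqP ->; rewrite addrC addrA.
Qed.

(** Since [lead_coef (V m)] is invertible, the equation [L(V m) = delta_{m,0}]
    can be solved for [mu m] in terms of the earlier moments. *)
Lemma moments_exist : V 0 = 1 -> exists mu : nat -> 'M[F]_n.+1,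
  forall m, moment_form mu 0 (V m) = (m == 0)%:R.
Proof.
move=> V0.
pose next m (g : nat -> 'M[F]_n.+1) : 'M[F]_n.+1 :=
  (lead_coef (V m))^-1 * ((m == 0)%:R - \sum_(d < m) (V m)`_d * g d).
(* g m holds the moments below m, and 0 elsewhere. *)
pose g := fix g m i := if m is p.+1 then
   if i == p then next p (g p) else g p i else 0.
have gE m i : (i < m)%N -> g m i = g i.+1 i.
  elim: m => // m IH; rewrite ltnS leq_eqVlt => /predU1P[->//|lt_im].
  by rewrite /= (ltn_eqF lt_im) IH //=.
exists (fun i => g i.+1 i) => m.
rewrite /moment_form V_size big_ord_recr V_coef /= addn0 eqxx.
rewrite (mulVKr (V_lead_unit m)) (eq_bigr (fun d : 'I_m => (V m)`_d * g m d)).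
  by rewrite addrC subrK.
by move=> d _; rewrite addn0 [in RHS]gE.
Qed.

(** The recurrence lowers [L(V_m x^k)] to [C_m L(V_{m-1} x^{k-1})]
    when [k <= m], so these values reduce to the ones for [k = 0]. *)
Lemma orthogonal_of_recurrence (mu A B C : nat -> 'M[F]_n.+1) :
  (forall m, is_trig_mx (C m.+1)^T /\ C m.+1 \in unitmx) ->
  (forall m, 'X * V m.+1 = (A m.+1)%:P * V m.+2 + (B m.+1)%:P * V m.+1
                           + (C m.+1)%:P * V m) ->
  (forall m, moment_form mu 0 (V m) = (m == 0)%:R) ->
  exists Omega : nat -> 'M[F]_n.+1,
    (forall m, is_trig_mx (Omega m)^T /\ Omega m \in unitmx) /\
    (forall m k, (k <= m)%N ->
       moment_form mu k (V m) = if k == m then Omega m else 0).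
Proof.
move=> Ctu rec Vmu.
pose Omega := fix O m : 'M[F]_n.+1 := if m is p.+1 then C m * O p else 1.
exists Omega; split.
  elim=> [|m [Ot Ou]] /=; first by rewrite trmx1 scalar_mx_is_trig unitr1.
  have [Ct Cu] := Ctu m; split; last first.
    change (C m.+1 * Omega m \is a GRing.unit).
    by rewrite unitrMl.
  by rewrite trmx_mul is_trig_mxM.
move=> m k; elim: k m => [|k IH] [|m] le_km; [exact: Vmu | exact: Vmu | by [] |].
rewrite -moment_formXM rec !moment_formD !moment_formCM !IH // 1?ltnW // 1?ltnW //.
rewrite (ltn_eqF (_ : (k < m.+2)%N)) 1?ltnW // (ltn_eqF (_ : (k < m.+1)%N)) //.
by rewrite !mulr0 !add0r eqSS; case: eqP => // _; rewrite mulr0.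
Qed.

End Favard.

(** * Integration against a signed measure *)

Section MeasureSum.
Context {d : measure_display} {T : measurableType d} {R : realType}.
Variables m m1 m2 : {measure set T -> \bar R}.
Hypothesis mD : forall A, measurable A -> m A = (m1 A + m2 A)%E.

Let mE A : measurable A -> A `<=` setT -> m A = measure_add m1 m2 A.
Proof. by move=> mA _; rewrite measure_addE mD. Qed.

Lemma integrable_measure_sum (f : T -> \bar R) :
  m.-integrable setT f <-> m1.-integrable setT f /\ m2.-integrable setT f.
Proof.
have fE : measurable_fun setT f ->
    (\int[m]_x `|f x| = \int[m1]_x `|f x| + \int[m2]_x `|f x|)%E.
  move=> mf; rewrite (eq_measure_integral _ mE) ge0_integral_measure_add //.
  exact: measurableT_comp.
split=> [/integrableP[mf]|[/integrableP[mf f1] /integrableP[_ f2]]].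
  rewrite fE // => flty; split; apply/integrableP; split=> //.
    by apply: le_lt_trans flty; rewrite leeDl // integral_ge0.
  by apply: le_lt_trans flty; rewrite leeDr // integral_ge0.
by apply/integrableP; split=> //; rewrite fE // lte_add_pinfty.
Qed.

Lemma Rintegral_measure_sum (f : T -> R) : m.-integrable setT (EFin \o f) ->
  \int[m]_x f x = \int[m1]_x f x + \int[m2]_x f x.
Proof.
move=> /integrable_measure_sum[f1 f2]; rewrite /Rintegral.
rewrite (eq_measure_integral _ mE) integral_measure_add //.
by rewrite fineD //; exact: integrable_fin_num.
Qed.

End MeasureSum.

Section SignedIntegral.
Context {d : measure_display} {T : measurableType d} {R : realType}.
Variable nu : {charge set T -> \bar R}.

Lemma charge_integrable_jordan (f : T -> R) :
  charge_integrable nu f <->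
  (jordan_pos (hahn_setsP nu)).-integrable setT (EFin \o f) /\
  (jordan_neg (hahn_setsP nu)).-integrable setT (EFin \o f).
Proof. exact: integrable_measure_sum. Qed.

(** If [nu = P - N] and [(X, Y)] is a Hahn decomposition, then [P] and [N] exceed
    the Jordan parts of [nu] by one and the same measure, namely [P] on [Y]
    plus [N] on [X]. It cancels in the difference of the integrals. *)
Lemma charge_integral_difference (P N : {finite_measure set T -> \bar R})
    (f : T -> R) :
  (forall A, measurable A -> nu A = P A - N A)%E ->
  P.-integrable setT (EFin \o f) -> N.-integrable setT (EFin \o f) ->
  charge_integrable nu f /\
  charge_integral nu f = \int[P]_x f x - \int[N]_x f x.
Proof.
move=> nuE fP fN; have [[mX _] [mY _] XYT XY0] := hahn_setsP nu.
set X := hahn_pos_set nu in mX XYT XY0.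
set Y := hahn_neg_set nu in mY XYT XY0.
pose K := measure_add (mrestr P mY) (mrestr N mX).
have splitE (m : {finite_measure set T -> \bar R}) A : measurable A ->
    m A = (m (A `&` X) + m (A `&` Y))%E.
  move=> mA; rewrite -[in LHS](setIT A) -XYT setIUr measureU //;
    try exact: measurableI.
  by rewrite setIACA XY0 setI0.
have KE A : K A = (P (A `&` Y) + N (A `&` X))%E by rewrite /K measure_addE.
have fin (m : {finite_measure set T -> \bar R}) A B :
    measurable A -> measurable B -> m (A `&` B) \is a fin_num.
  by move=> mA mB; apply: fin_num_measure; exact: measurableI.
have PE A : measurable A -> P A = (jordan_pos (hahn_setsP nu) A + K A)%E.
  move=> mA; rewrite jordan_posE cjordan_posE /crestr0 mem_set // /crestr KE.
  rewrite nuE ?(splitE P A) //; last exact: measurableI.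
  by rewrite [(P (A `&` Y) + _)%E]addeC addeA subeK ?fin.
have NE A : measurable A -> N A = (jordan_neg (hahn_setsP nu) A + K A)%E.
  move=> mA; rewrite jordan_negE cjordan_negE /crestr0 mem_set // /crestr KE.
  rewrite nuE ?(splitE N A) //; last exact: measurableI.
  rewrite fin_num_oppeB ?fin // [(- P _ + _)%E]addeC addeA subeK ?fin //.
  by rewrite addeC.
have [f1 fK] := (integrable_measure_sum PE _).1 fP.
have [f2 _] := (integrable_measure_sum NE _).1 fN.
split; first exact/charge_integrable_jordan.
rewrite /charge_integral.
rewrite (Rintegral_measure_sum PE fP) (Rintegral_measure_sum NE fN).
by rewrite opprD addrACA subrr addr0.
Qed.

Lemma charge_integrableZD (a : R) (f g : T -> R) :
  charge_integrable nu f -> charge_integrable nu g ->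
  charge_integrable nu (fun x => a * f x + g x) /\
  charge_integral nu (fun x => a * f x + g x) =
    a * charge_integral nu f + charge_integral nu g.
Proof.
move=> /charge_integrable_jordan[f1 f2] /charge_integrable_jordan[g1 g2].
have af (m : {measure set T -> \bar R}) : m.-integrable setT (EFin \o f) ->
    m.-integrable setT (EFin \o (fun x => a * f x)).
  move=> fm; apply: (eq_integrable _ (fun x => a%:E * (f x)%:E)%E) => //.
  exact: integrableZl.
split; last first.
  rewrite /charge_integral !RintegralD //; try exact: af.
  by rewrite !RintegralZl // opprD addrACA mulrBr.
apply/charge_integrable_jordan; split;
  apply: (eq_integrable _ ((EFin \o (fun x => a * f x)%R) \+ (EFin \o g))%E) => //;
  by apply: integrableD => //; exact: af.
Qed.

Lemma charge_integrable0 : charge_integrable nu (fun=> 0) /\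
  charge_integral nu (fun=> 0) = 0.
Proof.
split; first exact: integrable0.
by rewrite /charge_integral /Rintegral !integral0 subrr.
Qed.

Lemma charge_integral_lin I (s : seq I) (c : I -> R) (f : I -> T -> R) :
  (forall i, charge_integrable nu (f i)) ->
  charge_integrable nu (fun x => \sum_(i <- s) c i * f i x) /\
  charge_integral nu (fun x => \sum_(i <- s) c i * f i x) =
    \sum_(i <- s) c i * charge_integral nu (f i).
Proof.
move=> fint; elim: s => [|i s [IHi IHe]].
  under eq_fun do rewrite big_nil.
  by rewrite big_nil; exact: charge_integrable0.
under eq_fun do rewrite big_cons.
rewrite big_cons -IHe; exact: charge_integrableZD.
Qed.

End SignedIntegral.

(** * Atomic signed measures with prescribed moments *)

Lemma dual_moments (R : numFieldType) k : exists b : nat -> R,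
  forall i, (i <= k)%N -> \sum_(r < k.+1) b r * r%:R ^+ i = (i == k)%:R.
Proof.
pose A : 'M[R]_k.+1 := Vandermonde k.+1 (\row_(j < k.+1) j%:R).
have Au : A \in unitmx.
  rewrite unitmxE det_Vandermonde unitfE; apply/prodf_neq0 => i _.
  apply/prodf_neq0 => j lt_ij; rewrite !mxE subr_eq0 eqr_nat.
  by rewrite neq_ltn lt_ij orbT.
exists (fun r => (invmx A) (inord r) ord_max) => i le_ik.
have /matrixP/(_ (inord i) ord_max) := mulmxV Au.
rewrite !mxE -val_eqE /= inordK // => <-.
by apply: eq_bigr => r _; rewrite !mxE inord_val inordK // mulrC.
Qed.

(** The nodes [0, h, ..., k h] carry weights whose moments of order below [k]
    vanish. Normalising the moment of order [k] scales the weights by [h ^- k],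
    which makes the absolute moments of lower order [O(1/h)]. *)
Lemma moment_block (R : realFieldType) k (c e : R) : 0 < e ->
  exists ax : nat -> R * R,
    [/\ forall r, 0 <= (ax r).2,
        forall i, (i <= k)%N ->
          \sum_(r < k.+1) (ax r).1 * (ax r).2 ^+ i = c *+ (i == k) &
        forall i, (i < k)%N ->
          \sum_(r < k.+1) `|(ax r).1| * (ax r).2 ^+ i <= e].
Proof.
move=> e0; have [b bE] := dual_moments R k.
pose S i : R := \sum_(r < k.+1) `|b r| * r%:R ^+ i.
have S0 i : 0 <= S i by apply: sumr_ge0 => r _; rewrite mulr_ge0 ?exprn_ge0.
pose h : R := 1 + `|c| * (\sum_(i < k) S i) / e.
have h1 : 1 <= h by rewrite lerDl divr_ge0 ?mulr_ge0 ?sumr_ge0 // ltW.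
have h0 : 0 < h by rewrite (lt_le_trans ltr01).
exists (fun r => (c * b r / h ^+ k, h * r%:R)); split=> /=.
- by move=> r; rewrite mulr_ge0 // ltW.
- move=> i le_ik.
  transitivity (c * (h ^+ i / h ^+ k) * \sum_(r < k.+1) b r * r%:R ^+ i).
    rewrite mulr_sumr; apply: eq_bigr => r _; rewrite exprMn.
    by field; rewrite expf_neq0 ?gt_eqF.
  rewrite bE //; have [->|_] := eqVneq i k; last by rewrite mulr0.
  by rewrite divff ?expf_neq0 ?gt_eqF // !mulr1.
move=> i lt_ik.
have -> : \sum_(r < k.+1) `|c * b r / h ^+ k| * (h * r%:R) ^+ i =
    `|c| * S i * h ^- (k - i).
  rewrite mulr_sumr mulr_suml; apply: eq_bigr => r _.
  rewrite !normrM normfV (ger0_norm (exprn_ge0 _ (ltW h0))) exprMn.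
  have -> : h ^+ k = h ^+ (k - i) * h ^+ i by rewrite -exprD subnK // ltnW.
  by field; rewrite !expf_neq0 ?gt_eqF.
have le_hk : h ^- (k - i) <= h^-1.
  by rewrite lef_pV2 ?posrE ?exprn_gt0 // ler_eXnr // subn_gt0.
apply: (@le_trans _ _ (`|c| * (\sum_(i < k) S i) * h^-1)).
  apply: ler_pM => //; rewrite ?mulr_ge0 ?invr_ge0 ?exprn_ge0 ?(ltW h0) //.
  by rewrite ler_wpM2l // (bigD1 (Ordinal lt_ik)) //= lerDl sumr_ge0.
by rewrite ler_pdivrMr // mulrDr mulr1 mulrCA divff ?gt_eqF // mulr1 lerDr ltW.
Qed.

(** Block [k] corrects the moment of order [k] left over by the blocks before it
    and does not disturb the moments of lower order. *)
Lemma moment_blocks (R : realFieldType) (s e : nat -> R) : (forall k, 0 < e k) ->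
  exists a x : nat -> nat -> R,
    [/\ forall k r, 0 <= x k r,
        forall k i, (i < k)%N -> \sum_(r < k.+1) a k r * x k r ^+ i = 0,
        forall k i, (i < k)%N -> \sum_(r < k.+1) `|a k r| * x k r ^+ i <= e k &
        forall k, \sum_(j < k.+1) \sum_(r < j.+1) a j r * x j r ^+ k = s k].
Proof.
move=> e0; pose block k c := projT1 (cid (moment_block k c (e0 k))).
have blockP k c := projT2 (cid (moment_block k c (e0 k))).
pose mom k c i := \sum_(r < k.+1) (block k c r).1 * (block k c r).2 ^+ i.
(* g k i is the moment of order i of the first k blocks together. *)
pose g := fix g k i := if k is p.+1 then g p i + mom p (s p - g p p) i else 0.
have gE k i : g k i = \sum_(j < k) mom j (s j - g j j) i.
  by elim: k => [|k IH]; rewrite ?big_ord0 // big_ord_recr /= IH.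
exists (fun k r => (block k (s k - g k k) r).1).
exists (fun k r => (block k (s k - g k k) r).2).
split=> [k r|k i lt_ik|k i lt_ik|k].
- by have [+ _ _] := blockP k (s k - g k k); apply.
- have [_ + _] := blockP k (s k - g k k) => /(_ i (ltnW lt_ik)) ->.
  by rewrite ltn_eqF.
- by have [_ _] := blockP k (s k - g k k); apply.
transitivity (g k.+1 k); first by rewrite gE.
have [_ + _] := blockP k (s k - g k k) => /(_ k (leqnn k)).
by rewrite eqxx mulr1n /= /mom => ->; rewrite addrC subrK.
Qed.

Lemma nneseries_dyadic_lty (R : realType) (u : nat -> R) (c : R) N :
  (forall k, 0 <= u k) -> (forall k, (N < k)%N -> u k <= c / (2 ^ k.+1)%:R) ->
  (\sum_(k <oo) (u k)%:E < +oo)%E.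
Proof.
move=> u0 uc.
(* C also dominates the finitely many terms up to N. *)
pose C : R := `|c| + \sum_(k < N.+1) u k * (2 ^ k.+1)%:R.
have C0 : 0 <= C by rewrite addr_ge0 ?sumr_ge0 // => k _; rewrite mulr_ge0.
apply: (@le_lt_trans _ _ (\sum_(k <oo) (C / (2 ^ k.+1)%:R)%:E)%E); last first.
  exact: le_lt_trans (epsilon_trick0 _ C0) (ltry _).
apply: lee_nneseries => [k _ _|k _]; rewrite lee_fin //.
rewrite ler_pdivlMr ?ltr0n ?expn_gt0 //.
have [lt_Nk|le_kN] := ltnP N k.
  have := uc k lt_Nk; rewrite ler_pdivlMr ?ltr0n ?expn_gt0 // => /le_trans; apply.
  rewrite (le_trans (ler_norm c)) // lerDl sumr_ge0 // => j _.
  by rewrite mulr_ge0.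
rewrite /C (bigD1 (Ordinal (le_kN : (k < N.+1)%N))) //=.
rewrite addrCA lerDl addr_ge0 ?sumr_ge0 //.
by move=> j _; rewrite mulr_ge0.
Qed.

Section AtomicMeasure.
Variables (R : realType) (w : nat -> nat -> {nonneg R}) (x : nat -> nat -> R).
Local Notation T := (measurableTypeR R).

Let block k : {measure set T -> \bar R} :=
  msum (fun r => mscale (w k r) (\d_(x k r : T) : {measure set T -> \bar R})) k.+1.

Definition atomic_measure : {measure set T -> \bar R} := mseries block 0.

Lemma ge0_integral_atomic (f : T -> R) : measurable_fun setT f ->
  (forall y, 0 <= f y) ->
  (\int[atomic_measure]_y (f y)%:E =
   \sum_(k <oo) (\sum_(r < k.+1) (w k r)%:num * f (x k r))%:E)%E.
Proof.
move=> mf f0.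
have mEf : measurable_fun setT (EFin \o f).
  exact/measurable_EFinP.
rewrite ge0_integral_measure_series //; last by move=> y _; rewrite lee_fin.
apply: eq_eseriesr => k _.
rewrite ge0_integral_measure_sum //; last by move=> y _; rewrite lee_fin.
rewrite -sumEFin; apply: eq_bigr => r _.
rewrite ge0_integral_mscale //; last by move=> y _; rewrite lee_fin.
by rewrite integral_dirac // diracT mul1e.
Qed.

(** The negative part of [f] vanishes at all atoms. *)
Lemma integral_atomic (f : T -> R) : measurable_fun setT f ->
  (forall k r, 0 <= f (x k r)) ->
  (\sum_(k <oo) (\sum_(r < k.+1) (w k r)%:num * f (x k r))%:E < +oo)%E ->
  atomic_measure.-integrable setT (EFin \o f) /\
  (\int[atomic_measure]_y (f y)%:E =
   \sum_(k <oo) (\sum_(r < k.+1) (w k r)%:num * f (x k r))%:E)%E.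
Proof.
move=> mf f0 flty.
have mEf : measurable_fun setT (EFin \o f).
  exact/measurable_EFinP.
split.
  apply/integrableP; split=> //.
  rewrite (eq_integral (fun y => (`|f y|)%:E)) //.
  rewrite (ge0_integral_atomic (f := fun y => `|f y|)) //;
    last exact: measurableT_comp.
  apply: le_lt_trans flty; rewrite le_eqVlt; apply/orP; left; apply/eqP.
  apply: eq_eseriesr => k _; congr EFin; apply: eq_bigr => r _.
  by rewrite ger0_norm.
rewrite integralE funerpos funerneg.
rewrite ge0_integral_atomic ?ge0_integral_atomic //;
  try by move=> y; rewrite /funrpos /funrneg le_max lexx orbT.
- rewrite [X in (_ - X)%E]eseries0 ?sube0.
    apply: eq_eseriesr => k _; congr EFin; apply: eq_bigr => r _.
    by rewrite /funrpos max_l.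
  move=> k _ _; rewrite big1 // => r _.
  by rewrite /funrneg max_r ?mulr0 // oppr_le0.
- exact: measurable_funrneg.
- exact: measurable_funrpos.
Qed.

End AtomicMeasure.

(** This is a theorem of Polya. The blocks are chosen so small that their absolute
    moments of any given order are eventually dominated by a geometric sequence.
    Giving the atoms the weights [|a|] and [|a| - a] produces two finite measures
    whose difference has the weights [a]; as blocks beyond the [i]-th contribute
    equally to both moments of order [i], the difference of these is a finite
    sum. *)
Lemma signed_measure_with_moments (R : realType) (s : nat -> R) :
  exists nu : borel_charge R, forall i,
    charge_integrable nu (fun x : measurableTypeR R => (x : R) ^+ i) /\
    charge_integral nu (fun x : measurableTypeR R => (x : R) ^+ i) = s i.
Proof.
pose e k : R := 1 / (2 ^ k.+1)%:R.
have e0 k : 0 < e k by rewrite divr_gt0 // ltr0n expn_gt0.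
have [a [x [x0 alow aabs asum]]] := moment_blocks s e0.
have p0 k r : 0 <= `|a k r| by [].
have q0 k r : 0 <= `|a k r| - a k r by rewrite subr_ge0 ler_norm.
pose p k r : {nonneg R} := NngNum (p0 k r).
pose q k r : {nonneg R} := NngNum (q0 k r).
pose u (w : nat -> nat -> {nonneg R}) i k : R :=
  \sum_(r < k.+1) (w k r)%:num * x k r ^+ i.
have u0 w i k : 0 <= u w i k.
  by apply: sumr_ge0 => r _; rewrite mulr_ge0 ?exprn_ge0.
have u_lty w : (forall k r, (w k r)%:num <= 2 * `|a k r|) ->
    forall i, (\sum_(k <oo) (u w i k)%:E < +oo)%E.
  move=> w2 i; apply: (@nneseries_dyadic_lty _ _ 2 i) => // k lt_ik.
  apply: (@le_trans _ _ (2 * \sum_(r < k.+1) `|a k r| * x k r ^+ i)).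
    rewrite mulr_sumr; apply: ler_sum => r _.
    by rewrite mulrA ler_wpM2r ?exprn_ge0.
  by rewrite ler_wpM2l // (le_trans (aabs k i lt_ik)) // /e mul1r.
have p_lty : forall i, (\sum_(k <oo) (u p i k)%:E < +oo)%E.
  by apply: u_lty => k r; rewrite /= ler_peMl // ler1n.
have q_lty : forall i, (\sum_(k <oo) (u q i k)%:E < +oo)%E.
  by apply: u_lty => k r; rewrite /= mulr2n mulrDl mul1r lerD2l -normrN ler_norm.
have momE w i : (\sum_(k <oo) (u w i k)%:E < +oo)%E ->
    (atomic_measure w x).-integrable setT
      (EFin \o (fun y : measurableTypeR R => (y : R) ^+ i)) /\
    (\int[atomic_measure w x]_y ((y : R) ^+ i)%:E =
     \sum_(k <oo) (u w i k)%:E)%E.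
  by apply: integral_atomic => [|k r]; [exact: exprn_measurable | exact: exprn_ge0].
have finP w : (forall i, \sum_(k <oo) (u w i k)%:E < +oo)%E ->
    fin_num_fun (atomic_measure w x).
  move=> wlty; apply: lty_fin_num_fun.
  have [_] := momE w 0 (wlty 0); under eq_integral do rewrite expr0.
  by rewrite integral_cst // mul1e => ->.
pose P : {finite_measure set (measurableTypeR R) -> \bar R} :=
  HB.pack (atomic_measure p x : set _ -> \bar R)
    (Measure.on (atomic_measure p x))
    (Measure_isFinite.Build _ _ _ _ (finP p p_lty)).
pose N : {finite_measure set (measurableTypeR R) -> \bar R} :=
  HB.pack (atomic_measure q x : set _ -> \bar R)
    (Measure.on (atomic_measure q x))
    (Measure_isFinite.Build _ _ _ _ (finP q q_lty)).
pose nu : borel_charge R :=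
  cadd (charge_of_finite_measure P) (copp (charge_of_finite_measure N)).
exists nu => i.
have nuE A : measurable A -> nu A = (P A - N A)%E by [].
have [pint pE] := momE p i (p_lty i); have [qint qE] := momE q i (q_lty i).
have [? ->] := charge_integral_difference nuE pint qint; split=> //.
rewrite /Rintegral pE qE.
have uE k : u p i k - u q i k = \sum_(r < k.+1) a k r * x k r ^+ i.
  by rewrite -sumrB; apply: eq_bigr => r _; rewrite -mulrBl opprB addrC subrK.
have tailE : (\sum_(i.+1 <= k <oo) (u p i k)%:E =
              \sum_(i.+1 <= k <oo) (u q i k)%:E)%E.
  rewrite -!(@nneseries_addn _ (fun k => (u _ i k)%:E)) //;
    try by move=> k; rewrite lee_fin.
  apply: eq_eseriesr => k _; congr EFin; apply/eqP.
  by rewrite -subr_eq0 uE alow // addnS ltnS leq_addl.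
have splitE w : (\sum_(k <oo) (u w i k)%:E =
    (\sum_(k < i.+1) u w i k)%:E + \sum_(i.+1 <= k <oo) (u w i k)%:E)%E.
  rewrite (@nneseries_split _ _ 0 i.+1) ?add0n; last by move=> k _; rewrite lee_fin.
  by rewrite big_mkord sumEFin.
have tail_fin : (\sum_(i.+1 <= k <oo) (u q i k)%:E)%E \is a fin_num.
  rewrite ge0_fin_numE; last by apply: nneseries_ge0 => k _ _; rewrite lee_fin.
  apply: le_lt_trans (q_lty i); rewrite splitE leeDr // lee_fin.
  exact: sumr_ge0.
rewrite !splitE tailE !fineD //= opprD addrACA subrr addr0 -sumrB.
by rewrite -[RHS]asum; apply: eq_bigr => k _; rewrite uE.
Qed.

(** * Favard's theorem for matrix measures *)

Definition mx_moment (R : realType) n (W : 'M[borel_charge R]_n) (d : nat) :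
    'M[R]_n :=
  \matrix_(i, j) charge_integral (W i j)
    (fun x : measurableTypeR R => (x : R) ^+ d).

Lemma mxpoly_evalE (R : realType) n (P : {poly 'M[R]_n.+1}) x i j :
  mxpoly_eval P x i j = \sum_(d < size P) P`_d i j * x ^+ d.
Proof.
rewrite /mxpoly_eval horner_coef summxE; apply: eq_bigr => d _.
by rewrite -rmorphXn -mulmxE mul_mx_scalar mxE mulrC.
Qed.

(** Finite moments make every entry of [P(x) x^k] integrable, so the integral can
    be taken monomial by monomial. *)
Lemma mx_integral_moment_form (R : realType) n (W : 'M[borel_charge R]_n.+1)
    (P : {poly 'M[R]_n.+1}) k :
  finite_moments W ->
  mx_integral (mxpoly_eval P) W (fun x => x ^+ k) = moment_form (mx_moment W) k P.
Proof.
move=> Wfin; apply/matrixP => i j; rewrite mxE summxE.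
under [RHS]eq_bigr do rewrite mxE.
rewrite exchange_big /=; apply: eq_bigr => l _.
rewrite (_ : (fun _ => _) = fun x : measurableTypeR R =>
  \sum_(d < size P) P`_d i l * (x : R) ^+ (d + k)); last first.
  apply/funext => x; rewrite mxpoly_evalE mulr_suml.
  by apply: eq_bigr => d _; rewrite exprD mulrA.
have [_ ->] := charge_integral_lin (index_enum _)
  (fun d : 'I_(size P) => P`_d i l) (fun d => Wfin l j (d + k)%N).
by apply: eq_bigr => d _; rewrite mxE.
Qed.

Theorem theorem10 (R : realType) (n : nat) (V : nat -> {poly 'M[R]_n.+1})
    (V_size : forall m : nat, size (V m) = m.+1)
    (V_lead_trig : forall m : nat, is_trig_mx (lead_coef (V m)))
    (V_lead_unit : forall m : nat, lead_coef (V m) \in unitmx)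
    (V_0 : V 0%N = 1) :
  (exists W : 'M[borel_charge R]_n.+1,
      finite_moments W /\ left_orthogonal V W)
  <->
  (exists A B C : nat -> 'M[R]_n.+1,
      (forall m : nat, is_trig_mx (A m) /\ A m \in unitmx) /\
      (forall m : nat, is_trig_mx (C m.+1)^T /\ C m.+1 \in unitmx) /\
      (forall m : nat, (1 <= m)%N ->
         'X * V m = (A m)%:P * V m.+1 + (B m)%:P * V m
                    + (C m)%:P * prev_poly V m)).
Proof.
split=> [[W [Wfin [Om [Otu Worth]]]]|[A [B [C [_ [Ctu rec]]]]]].
  have orth m k : (k <= m)%N ->
      moment_form (mx_moment W) k (V m) = if k == m then Om m else 0.
    by rewrite -mx_integral_moment_form //; exact: Worth.
  have [A [B [C [Atu Ctu rec]]]] :=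
    recurrence_of_orthogonal V_size V_lead_trig V_lead_unit Otu orth.
  by exists A, B, C; split=> //; split=> // -[|m] // _; exact: rec.
have [mu muV] := moments_exist V_size V_lead_unit V_0.
have [Om [Otu orth]] := orthogonal_of_recurrence Ctu (fun m => rec m.+1 isT) muV.
have nuP i j := cid (signed_measure_with_moments (fun d => mu d i j)).
pose W : 'M[borel_charge R]_n.+1 := \matrix_(i, j) projT1 (nuP i j).
have Wfin : finite_moments W.
  by move=> i j d; rewrite mxE; have [] := projT2 (nuP i j) d.
have WE : mx_moment W = mu.
  apply/funext => d; apply/matrixP => i j; rewrite !mxE.
  by have [] := projT2 (nuP i j) d.
exists W; split=> //; exists Om; split=> // m k le_km.
by rewrite mx_integral_moment_form // WE; exact: orth.
Qed.
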